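(* For every $o\in J$, the minimum face of $\mathrm{DMU}_o$ is equal to the convex hull of its global reference set, i.e. $\Gamma_o^{\min}=\mathrm{conv}\left(R_o^G\right)$.
   Context: Setting. There are $n$ observed decision making units $\mathrm{DMU}_j$, $j\in J=\{1,\dots,n\}$, with input vectors $\mathbf{x}_j=(x_{1j},\dots,x_{mj})^T\in\mathbb{R}^m_{\ge 0}$ and output vectors $\mathbf{y}_j=(y_{1j},\dots,y_{sj})^T\in\mathbb{R}^s_{\ge 0}$; $\mathrm{DMU}_j$ is identified with the point $(\mathbf{x}_j,\mathbf{y}_j)$ when convex hulls are taken. The technology set is $$T=\Big\{(\mathbf{x},\mathbf{y})\in\mathbb{R}^{m+s}_{\ge 0} \,\Big|\, \sum_{j\in J}\lambda_j\mathbf{x}_j\le\mathbf{x},\ \sum_{j\in J}\lambda_j\mathbf{y}_j\ge\mathbf{y},\ \sum_{j\in J}\lambda_j=1,\ \lambda_j\ge 0\ \forall j\in J\Big\}.$$ RAM model. Let $R_i^-=\max_{j\in J} x_{ij}-\min_{j\in J}x_{ij}$ and $R_r^+=\max_{j\in J} y_{rj}-\min_{j\in J}y_{rj}$ (all nonzero, so that the model below is defined). For $o\in J$, the RAM model of $\mathrm{DMU}_o$ is $$\rho_o=\min\ 1-\frac{1}{m+s}\Big\{\sum_{i=1}^m\frac{s_i^-}{R_i^-}+\sum_{r=1}^s\frac{s_r^+}{R_r^+}\Big\}$$ subject to $\sum_{j\in J}\lambda_jx_{ij}+s_i^-=x_{io}$ $(i=1,\dots,m)$, $\sum_{j\in J}\lambda_jy_{rj}-s_r^+=y_{ro}$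 $(r=1,\dots,s)$, $\sum_{j\in J}\lambda_j=1$, $\lambda_j\ge0$, $s_i^-\ge0$, $s_r^+\ge0$. Projections. For an optimal solution $(\boldsymbol{\lambda}^*,\mathbf{s}^{-*},\mathbf{s}^{+*})$ of the RAM model of $\mathrm{DMU}_o$, the associated projection of $\mathrm{DMU}_o$ is the point $P=(\mathbf{x}_o-\mathbf{s}^{-*},\mathbf{y}_o+\mathbf{s}^{+*})$. The projection set $\Lambda_o$ is the set of all projections of $\mathrm{DMU}_o$ (over all optimal solutions). Reference sets. For $P\in\Lambda_o$, the maximal reference set is $R_{oP}^M=\{\mathrm{DMU}_j \mid \lambda_j^*>0$ in some optimal solution of the RAM model of $\mathrm{DMU}_o$ associated with $P\}$. The global reference set (GRS) of $\mathrm{DMU}_o$ is $R_o^G=\bigcup_{P\in\Lambda_o}R_{oP}^M$. Faces. A face of $T$ is a set $F=H\cap T$ where $H$ is a supporting hyperplane of $T$. The minimum face of $\mathrm{DMU}_o$ is $$\Gamma_o^{\min}=\bigcap\{F \mid F\text{ is a face of }T\text{ and }\Lambda_o\subseteq F\}.$$ *)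

(* Defs.v *)
From mathcomp Require Import all_boot all_order all_algebra.
From mathcomp Require Import classical_sets reals convex.

Set Implicit Arguments.
Unset Strict Implicit.
Unset Printing Implicit Defensive.

Import Order.TTheory GRing.Theory Num.Theory.

Local Open Scope classical_set_scope.
Local Open Scope ring_scope.

(* The data are an m x n input matrix X and an s x n output matrix Y, so that
   DMU_j is the point (col j X, col j Y) of R^m x R^s. *)

Notation point R m s := ('cV[R]_m * 'cV[R]_s)%type (only parsing).

Definition DMU (R : realType) (m s n : nat) (X : 'M[R]_(m, n))
    (Y : 'M[R]_(s, n)) (j : 'I_n) : point R m s :=
  (col j X, col j Y).

Definition technology (R : realType) (m s n : nat) (X : 'M[R]_(m, n))
    (Y : 'M[R]_(s, n)) : set (point R m s) :=
  [set z : point R m s | (forall i, 0 <= z.1 i 0) /\ (forall r, 0 <= z.2 r 0) /\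
     exists lambda : 'I_n -> R,
       [/\ forall i, \sum_j lambda j * X i j <= z.1 i 0,
           forall r, \sum_j lambda j * Y r j >= z.2 r 0,
           \sum_j lambda j = 1
         & forall j, 0 <= lambda j]].

(* max_j f j - min_j f j; f o only seeds the two iterated operations, and the
   value does not depend on o since o lies in the index range. *)
Definition spread (R : realType) (n : nat) (o : 'I_n) (f : 'I_n -> R) : R :=
  \big[Num.max/f o]_j f j - \big[Num.min/f o]_j f j.

(* A solution of the RAM model: intensities, input slacks, output slacks. *)
Record ram_sol (R : realType) (m s n : nat) := RamSol {
  intensity : 'I_n -> R;
  in_slack : 'cV[R]_m;
  out_slack : 'cV[R]_s
}.

Definition ram_feasible (R : realType) (m s n : nat) (X : 'M[R]_(m, n))
    (Y : 'M[R]_(s, n)) (o : 'I_n) (w : ram_sol R m s n) : Prop :=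
  [/\ forall i, \sum_j intensity w j * X i j + in_slack w i 0 = X i o,
      forall r, \sum_j intensity w j * Y r j - out_slack w r 0 = Y r o,
      \sum_j intensity w j = 1,
      forall j, 0 <= intensity w j
    & (forall i, 0 <= in_slack w i 0) /\ (forall r, 0 <= out_slack w r 0)].

Definition ram_obj (R : realType) (m s n : nat) (X : 'M[R]_(m, n))
    (Y : 'M[R]_(s, n)) (o : 'I_n) (w : ram_sol R m s n) : R :=
  1 - (m + s)%:R^-1 *
    (\sum_i in_slack w i 0 / spread o (X i) +
     \sum_r out_slack w r 0 / spread o (Y r)).

Definition ram_optimal (R : realType) (m s n : nat) (X : 'M[R]_(m, n))
    (Y : 'M[R]_(s, n)) (o : 'I_n) (w : ram_sol R m s n) : Prop :=
  ram_feasible X Y o w /\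
  forall w', ram_feasible X Y o w' -> ram_obj X Y o w <= ram_obj X Y o w'.

Definition projection (R : realType) (m s n : nat) (X : 'M[R]_(m, n))
    (Y : 'M[R]_(s, n)) (o : 'I_n) (w : ram_sol R m s n) : point R m s :=
  (col o X - in_slack w, col o Y + out_slack w).

Definition projection_set (R : realType) (m s n : nat) (X : 'M[R]_(m, n))
    (Y : 'M[R]_(s, n)) (o : 'I_n) : set (point R m s) :=
  [set projection X Y o w | w in ram_optimal X Y o].

(* Reference sets are sets of indices of DMUs; their points are obtained as
   images under DMU X Y. *)
Definition maximal_reference_set (R : realType) (m s n : nat)
    (X : 'M[R]_(m, n)) (Y : 'M[R]_(s, n)) (o : 'I_n) (P : point R m s) :
    set 'I_n :=
  [set j | exists w, [/\ ram_optimal X Y o w, projection X Y o w = P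
                       & 0 < intensity w j]].

Definition global_reference_set (R : realType) (m s n : nat)
    (X : 'M[R]_(m, n)) (Y : 'M[R]_(s, n)) (o : 'I_n) : set 'I_n :=
  \bigcup_(P in projection_set X Y o) maximal_reference_set X Y o P.

Definition inner (R : realType) (m s : nat) (a z : point R m s) : R :=
  \sum_i a.1 i 0 * z.1 i 0 + \sum_r a.2 r 0 * z.2 r 0.

Definition supporting_hyperplane (R : realType) (m s : nat)
    (T H : set (point R m s)) : Prop :=
  exists (a : point R m s) (b : R),
    [/\ a <> 0, H = [set z | inner a z = b],
        T `<=` [set z | inner a z <= b] & H `&` T !=set0].

Definition face (R : realType) (m s : nat) (T F : set (point R m s)) : Prop :=
  exists2 H, supporting_hyperplane T H & F = H `&` T.

Definition minimum_face (R : realType) (m s n : nat) (X : 'M[R]_(m, n))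
    (Y : 'M[R]_(s, n)) (o : 'I_n) : set (point R m s) :=
  \bigcap_(F in [set F | face (technology X Y) F /\
                         projection_set X Y o `<=` F]) F.

Definition convex_hull (R : realType) (V : lmodType R) (S : set V) : set V :=
  smallest (@convex_set R V) S.

(* Main.v *)
Require Import Defs.
From mathcomp Require Import all_boot all_order all_algebra.
From mathcomp Require Import classical_sets reals convex.
From mathcomp Require Import boolp interval_inference ring.

(** Only the position of a point relative to DMU_o matters.  Call gain of a
point z = (x, y) the vector (x_o - x, y - y_o), whose entries are the input
savings and the output increases, and let D be the matrix whose j-th row is the
gain of DMU_j.  The RAM model then reads: maximise lambda D w over the convex
weights lambda with lambda D >= 0, where w > 0 collects the inverse spreads.

The inclusion of the hull in the minimum face is soft.  A projection is a convex
combination of the DMUs of an optimal solution; if it lies on a supporting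
hyperplane of T, so do all the DMUs that enter it with a positive weight
([DMU_in_face]), and a face is convex.

For the converse, one face of T that contains the projection set and lies in the
hull is enough.  Strict complementarity of linear programming provides it: there
are an optimal lambda, of value V, and multipliers y >= 0 such that u = w + y
satisfies D u <= V, with equality in row j only if lambda_j > 0, that is, only
if DMU_j is in the global reference set ([lp_strict_complementarity]).  The
hyperplane of the points z with gain(z) u = V

- contains every projection, by weak duality ([lp_weak_duality]);
- meets T only inside the hull, because u is positive in every coordinate, so
  that a point of the hyperplane cannot be dominated by a different convex
  combination of DMUs ([positive_face_sub_hull]).

Strict complementarity comes from the lemma of Farkas ([farkas]), through
Tucker's theorem on complementary nonnegative solutions
([nonneg_kernel_complementarity]).  The value V enters as a supremum; that it is
attained is a by-product of strict complementarity.

If there are no inputs and no outputs, the space is a single point without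
hyperplanes, hence T has no face and the minimum face is the whole space; the
hull is the whole space too, as an optimal solution exists. *)

Set Implicit Arguments.
Unset Strict Implicit.
Unset Printing Implicit Defensive.

Import Order.TTheory GRing.Theory Num.Theory.

Local Open Scope classical_set_scope.
Local Open Scope ring_scope.

(** * Theorems of the alternative *)

Definition nonneg_mx (R : numDomainType) p q (A : 'M[R]_(p, q)) :=
  forall i j, 0 <= A i j.

Lemma nonneg_mxD (R : numDomainType) p q (A B : 'M[R]_(p, q)) :
  nonneg_mx A -> nonneg_mx B -> nonneg_mx (A + B).
Proof. by move=> A0 B0 i j; rewrite mxE addr_ge0. Qed.

Lemma nonneg_mxZ (R : numDomainType) p q a (A : 'M[R]_(p, q)) :
  0 <= a -> nonneg_mx A -> nonneg_mx (a *: A).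
Proof. by move=> a0 A0 i j; rewrite mxE mulr_ge0. Qed.

Lemma nonneg_mxM (R : numDomainType) p q r (A : 'M[R]_(p, q))
    (B : 'M[R]_(q, r)) :
  nonneg_mx A -> nonneg_mx B -> nonneg_mx (A *m B).
Proof. by move=> A0 B0 i j; rewrite mxE sumr_ge0 // => k _; rewrite mulr_ge0. Qed.

Lemma nonneg_col_mx (R : numDomainType) p1 p2 q (A : 'M[R]_(p1, q))
    (B : 'M[R]_(p2, q)) :
  nonneg_mx A -> nonneg_mx B -> nonneg_mx (col_mx A B).
Proof. by move=> A0 B0 i j; rewrite mxE; case: splitP. Qed.

Lemma nonneg_row_mx (R : numDomainType) p q1 q2 (A : 'M[R]_(p, q1))
    (B : 'M[R]_(p, q2)) :
  nonneg_mx A -> nonneg_mx B -> nonneg_mx (row_mx A B).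
Proof. by move=> A0 B0 i j; rewrite mxE; case: splitP. Qed.

(** Induction on the number of rows.  Let a be the first row of A and B the rest.
If y separates b from the cone of B but not from a, so that a y < 0, all the
vectors are pushed along a into the hyperplane orthogonal to y: v becomes
(v y) a - (a y) v, a nonnegative combination of a and v when v is a row of B.
The induction hypothesis in that hyperplane then gives either coefficients for b
in the original cone, or a separating vector that can be made orthogonal to
a. *)
Lemma farkas (R : realFieldType) q p (A : 'M[R]_(q, p)) (b : 'rV[R]_p) :
  (exists2 x : 'rV_q, nonneg_mx x & x *m A = b) \/
  (exists2 y : 'cV_p, nonneg_mx (A *m y) & (b *m y) 0 0 < 0).
Proof.
elim: q A b => [|q IHq] A b.
  have [->|/rV0Pn[k bk]] := eqVneq b 0.
    by left; exists 0; rewrite ?mul0mx // => i [].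
  right; exists (- b 0 k *: delta_mx k 0); first by case.
  rewrite -scalemxAr -colE !mxE mulNr oppr_lt0.
  by rewrite -expr2 exprn_even_gt0.
move: A; rewrite -[q.+1]/(1 + q)%N => A.
rewrite -[A]vsubmxK; set a := usubmx A; set B := dsubmx A.
have [[x x0 xB]|[y By by0]] := IHq B b.
  left; exists (row_mx 0 x); last by rewrite mul_row_col mul0mx add0r.
  by apply: nonneg_row_mx => // i j; rewrite mxE.
set al := (a *m y) 0 0.
have ayE : a *m y = al%:M by rewrite [LHS]mx11_scalar.
have [al0|al0] := leP 0 al.
  right; exists y => //; rewrite mul_col_mx; apply: nonneg_col_mx => //.
  by move=> i j; rewrite ayE !ord1 !mxE.
have [[x x0 xB]|[y' By' by']] :=
    IHq (B *m y *m a - al *: B) (b *m y *m a - al *: b).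
  set be := (b *m y) 0 0; set ga := (x *m B *m y) 0 0.
  have byE : b *m y = be%:M by rewrite [LHS]mx11_scalar.
  have xByE : x *m B *m y = ga%:M by rewrite [LHS]mx11_scalar.
  (* The weight of a is read off x B' = b' after division by al < 0; it is
     nonnegative because b y < 0 <= x B y. *)
  left; exists (row_mx (al^-1 * (be - ga))%:M x).
    apply: nonneg_row_mx => // i j; rewrite !ord1 mxE eqxx mulr1n.
    rewrite nmulr_rge0 ?invr_lt0 // subr_le0 (le_trans (ltW by0)) //.
    by rewrite /ga -mulmxA nonneg_mxM.
  rewrite mul_row_col mul_scalar_mx; apply: (scalerI (ltr0_neq0 al0)).
  rewrite scalerDr scalerA mulrA mulfV ?ltr0_neq0 // mul1r scalerBl.
  move: xB; rewrite mulmxBr -scalemxAr !mulmxA byE xByE !mul_scalar_mx => xB.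
  by rewrite -[al *: (x *m B)](subKr (ga *: a)) xB addrA subrK subKr.
(* This combination of y and y' is orthogonal to a, and its product with any v
   is that of y' with the pushed v. *)
right; exists ((a *m y') 0 0 *: y - al *: y').
  rewrite mul_col_mx; apply: nonneg_col_mx.
    rewrite mulmxBr -!scalemxAr ayE {2}[a *m y']mx11_scalar => i j.
    by rewrite !mxE !ord1 !mulr1n mulrC subrr.
  move: By'; rewrite mulmxBl mulmxBr -scalemxAl -!scalemxAr -[_ *m a *m y']mulmxA.
  by rewrite {1}[a *m y']mx11_scalar mul_mx_scalar.
move: by'; rewrite mulmxBl mulmxBr -scalemxAl -!scalemxAr -[_ *m a *m y']mulmxA.
by rewrite {1}[a *m y']mx11_scalar mul_mx_scalar.
Qed.

(** Tucker's theorem.  The product of x and A y is zero, so at each index at most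
one of them is positive; the point is that exactly one is.  For one index j this
is the lemma of Farkas applied to - row j A; the sum over j of the solutions
obtained works for all indices at once. *)
Lemma nonneg_kernel_complementarity (R : realFieldType) q p (A : 'M[R]_(q, p)) :
  exists (x : 'rV_q) (y : 'cV_p),
    [/\ nonneg_mx x, x *m A = 0, nonneg_mx (A *m y)
      & forall j, 0 < x 0 j + (A *m y) j 0].
Proof.
have /fin_all_exists [xy xyP] : forall j, exists xy : 'rV_q * 'cV_p,
    [/\ nonneg_mx xy.1, xy.1 *m A = 0, nonneg_mx (A *m xy.2)
      & 0 < xy.1 0 j + (A *m xy.2) j 0].
  move=> j; have [[x x0 xA]|[y Ay ajy]] := farkas A (- row j A).
    exists (delta_mx 0 j + x, 0); split=> /=.
    - by apply: nonneg_mxD => // i k; rewrite mxE ler0n.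
    - by rewrite mulmxDl -rowE xA subrr.
    - by move=> i k; rewrite mulmx0 mxE.
    - by rewrite mulmx0 !mxE !eqxx addr0 ltr_pwDl.
  exists (0, y); split=> //=.
  - by move=> i k; rewrite mxE.
  - by rewrite mul0mx.
  - by move: ajy; rewrite mulNmx -row_mul !mxE add0r oppr_lt0.
exists (\sum_j (xy j).1), (\sum_j (xy j).2); split.
- by move=> i k; rewrite summxE sumr_ge0 // => j _; have [+ _ _ _] := xyP j; apply.
- by rewrite mulmx_suml big1 // => j _; have [_ -> _ _] := xyP j.
- move=> i k; rewrite mulmx_sumr summxE sumr_ge0 // => j _.
  by have [_ _ + _] := xyP j; apply.
- move=> j; rewrite mulmx_sumr !summxE -big_split /= (bigD1 j) //=.
  have [_ _ _ xyj] := xyP j.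
  rewrite ltr_pwDl // sumr_ge0 // => k _; have [x0 _ y0 _] := xyP k.
  by rewrite addr_ge0.
Qed.

(** The inequality form of the previous lemma, obtained by adding one slack
row for each column of M. *)
Lemma strict_complementarity (R : realFieldType) q p (M : 'M[R]_(q, p)) :
  exists (x : 'rV_q) (y : 'cV_p),
    [/\ nonneg_mx x, nonneg_mx y, nonneg_mx (x *m M), nonneg_mx (- (M *m y)) &
        (forall j, 0 < x 0 j - (M *m y) j 0) /\
        (forall k, 0 < y k 0 + (x *m M) 0 k)].
Proof.
have [x [y [x0 xA Ay xy]]] := nonneg_kernel_complementarity (col_mx (- M) 1%:M).
move: xA Ay xy; rewrite -[x]hsubmxK mul_row_col mulmxN mulmx1 addrC => /subr0_eq xM.
rewrite mul_col_mx mul1mx mulNmx => Ay xy.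
exists (lsubmx x), y; split.
- by move=> i j; rewrite mxE.
- by move=> i j; move: (Ay (rshift q i) j); rewrite col_mxEd.
- by rewrite -xM => i j; rewrite mxE.
- by move=> i j; move: (Ay (lshift p i) j); rewrite col_mxEu.
split=> [j|k].
- by move: (xy (lshift p j)); rewrite row_mxEl col_mxEu [X in _ + X]mxE.
- by move: (xy (rshift q k)); rewrite row_mxEr col_mxEd xM addrC.
Qed.

(** * Linear programs over convex weights *)

Definition lp_feasible (R : realType) n p (D : 'M[R]_(n, p)) (lam : 'rV_n) :=
  [/\ nonneg_mx lam, \sum_j lam 0 j = 1 & nonneg_mx (lam *m D)].

Lemma lp_weak_duality (R : realType) n p (D : 'M[R]_(n, p)) (w y : 'cV_p)
    (V : R) (lam : 'rV_n) :
  nonneg_mx y -> (forall j, (D *m (w + y)) j 0 <= V) -> lp_feasible D lam ->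
  (lam *m D *m w) 0 0 <= (lam *m D *m (w + y)) 0 0 <= V.
Proof.
move=> y0 DV [lam0 lam1 lamD]; apply/andP; split.
  by rewrite mulmxDr [leRHS]mxE lerDl nonneg_mxM.
rewrite -mulmxA mxE -[leRHS]mul1r -lam1 mulr_suml.
by apply: ler_sum => j _; rewrite ler_wpM2l.
Qed.

(** Zero gain of row o makes the program feasible.  With V the supremum of its
values, strict complementarity for the matrix whose rows are (D_j, D_j w - V)
yields weights lam, multipliers y and a multiplier t of the last column.  Up to
scaling, lam is an optimal solution and y / t an optimal dual solution; the work
is to show that neither lam nor t vanishes. *)
Lemma lp_strict_complementarity (R : realType) n p (D : 'M[R]_(n, p))
    (w : 'cV_p) (o : 'I_n) :
  row o D = 0 ->
  exists (lam : 'rV_n) (y : 'cV_p),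
    [/\ lp_feasible D lam, nonneg_mx y,
        forall j, (D *m (w + y)) j 0 <= (lam *m D *m w) 0 0 &
        forall j, (D *m (w + y)) j 0 = (lam *m D *m w) 0 0 -> 0 < lam 0 j].
Proof.
move=> Do; pose g := D *m w.
have lamg lam : (lam *m D *m w) 0 0 = \sum_j lam 0 j * g j 0.
  by rewrite -mulmxA mxE.
pose E := [set r : R | exists2 lam, lp_feasible D lam & r = (lam *m D *m w) 0 0].
pose V := sup E.
have o_feas : lp_feasible D (delta_mx 0 o).
  split; first by move=> i j; rewrite mxE ler0n.
    rewrite (bigD1 o) //= big1 => [|j /negPf jo]; rewrite mxE ?jo ?andbF //.
    by rewrite !eqxx addr0.
  by move=> i j; rewrite -rowE Do mxE.
have y0_nonneg : nonneg_mx (0 : 'cV[R]_p) by move=> i j; rewrite mxE.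
have E_ubound y v : nonneg_mx y -> (forall j, (D *m (w + y)) j 0 <= v) ->
    ubound E v.
  move=> y0 yv _ [lam lam_feas ->].
  by have /andP[] := lp_weak_duality y0 yv lam_feas; apply: le_trans.
have E_le_V lam : lp_feasible D lam -> (lam *m D *m w) 0 0 <= V.
  move=> lam_feas; apply: ub_le_sup; last by exists lam.
  exists (\big[Num.max/g o 0]_j g j 0); apply: (E_ubound 0) => // j.
  by rewrite addr0; apply: (le_bigmax _ (fun j => g j 0)).
have V_le v : ubound E v -> V <= v.
  by apply: ge_sup; exists (((delta_mx 0 o : 'rV_n) *m D *m w) 0 0), (delta_mx 0 o).
have [lam [yt []]] := strict_complementarity (row_mx D (g - const_mx V)).
rewrite -[yt]vsubmxK; set y := usubmx yt; set t := dsubmx yt 0 0.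
have tE : dsubmx yt = t%:M by rewrite [LHS]mx11_scalar.
rewrite tE mul_row_col mul_mx_scalar mul_mx_row => lam0 yt0 lamM0 Myt [Mlam lamM].
have y0 : nonneg_mx y by move=> i j; move: (yt0 (lshift 1 i) j); rewrite col_mxEu.
have t0 : 0 <= t.
  by move: (yt0 (rshift p 0) 0); rewrite col_mxEd mxE eqxx mulr1n.
have lamD0 : nonneg_mx (lam *m D).
  by move=> i j; move: (lamM0 i (lshift 1 j)); rewrite row_mxEl.
pose S := \sum_j lam 0 j.
have lamgV : (lam *m (g - const_mx V)) 0 0 = (lam *m D *m w) 0 0 - S * V.
  rewrite mulmxBr mxE -mulmxA; congr (_ + _).
  by rewrite !mxE mulr_suml; congr (- _); apply: eq_bigr => j _; rewrite mxE.
have lamV : S * V <= (lam *m D *m w) 0 0.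
  by move: (lamM0 0 (rshift p 0)); rewrite row_mxEr lamgV subr_ge0.
have Myt_le j : (D *m y) j 0 + t * (g j 0 - V) <= 0.
  by move: (Myt j 0); rewrite !mxE oppr_ge0.
have Mlam_lt j : (D *m y) j 0 + t * (g j 0 - V) < lam 0 j.
  by rewrite -subr_gt0; move: (Mlam j); rewrite !mxE.
have t_lam : 0 < t + ((lam *m D *m w) 0 0 - S * V).
  move: (lamM (rshift p 0)); rewrite col_mxEd row_mxEr lamgV.
  by rewrite [t%:M _ _]mxE eqxx mulr1n.
have S0 : 0 <= S by apply: sumr_ge0.
have dualE j : 0 < t -> (D *m (w + t^-1 *: y)) j 0 =
    V + t^-1 * ((D *m y) j 0 + t * (g j 0 - V)).
  move=> t_gt0; rewrite mulmxDr -scalemxAr -/g mxE [X in _ + X]mxE.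
  by rewrite mulrDr mulKf ?gt_eqF // addrCA subrKC addrC.
have ty0 : 0 < t -> nonneg_mx (t^-1 *: y).
  by move=> t_gt0; apply: nonneg_mxZ; rewrite // invr_ge0.
(* If lam were zero, all dual inequalities would be strict, and weak duality
   would bound the values by a number less than their supremum. *)
have S_neq0 : S != 0.
  apply/eqP => S_eq0.
  have lam_eq0 j : lam 0 j = 0.
    by apply/eqP; move/eqP: S_eq0; rewrite psumr_eq0 // => /allP/(_ j (mem_index_enum _)).
  have Do0 (z : 'cV_p) : (D *m z) o 0 = 0.
    by have := row_mul o D z; rewrite Do mul0mx => /matrixP/(_ 0 0); rewrite !mxE.
  have t_gt0 : 0 < t.
    rewrite lt_def t0 andbT; apply/eqP => t_eq0; move: (Mlam_lt o).
    by rewrite t_eq0 Do0 lam_eq0 mul0r addr0 ltxx.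
  have dual_lt j : (D *m (w + t^-1 *: y)) j 0 < V.
    by rewrite dualE // gtrDl pmulr_rlt0 ?invr_gt0 // -(lam_eq0 j) Mlam_lt.
  pose dual j := (D *m (w + t^-1 *: y)) j 0.
  have : V <= \big[Num.max/dual o]_j dual j.
    by apply/V_le/(E_ubound _ _ (ty0 t_gt0)) => j; apply: (le_bigmax _ dual).
  by apply/negP; rewrite -ltNge; apply: bigmax_lt => [|j _]; apply: dual_lt.
have S_gt0 : 0 < S by rewrite lt_def S_neq0.
pose mu := S^-1 *: lam.
have mu_feas : lp_feasible D mu.
  split.
  - by apply: nonneg_mxZ; rewrite // invr_ge0.
  - under eq_bigr do rewrite mxE.
    by rewrite -mulr_sumr mulVf.
  - by rewrite -scalemxAl; apply: nonneg_mxZ; rewrite // invr_ge0.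
have muE : (mu *m D *m w) 0 0 = S^-1 * (lam *m D *m w) 0 0.
  by rewrite -!scalemxAl mxE.
have muV : (mu *m D *m w) 0 0 = V.
  by apply/le_anti; rewrite E_le_V // muE ler_pdivlMl.
(* The value V is attained at mu, so the last column has no slack and its
   multiplier is positive. *)
have t_gt0 : 0 < t.
  move: t_lam; rewrite -[(lam *m D *m w) 0 0](mulVKf S_neq0) -muE muV subrr.
  by rewrite addr0.
exists mu, (t^-1 *: y); split=> //; first exact: ty0.
  move=> j; rewrite muV dualE // gerDl pmulr_rle0 ?invr_gt0 //.
move=> j; rewrite muV dualE // => /(canRL (addKr _)); rewrite addNr.
move/eqP; rewrite mulf_eq0 invr_eq0 gt_eqF //= => /eqP bracket_eq0.
by rewrite mxE mulr_gt0 ?invr_gt0 // -bracket_eq0 Mlam_lt.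
Qed.

(** * Convex combinations *)

Lemma convex_setP (R : realType) (V : lmodType R) (A : set V) :
  @convex_set R V A <->
  forall x y t, 0 <= t -> t <= 1 -> A x -> A y -> A (t *: x + (1 - t) *: y).
Proof.
split=> [cA x y t t0 t1 Ax Ay|cA x y t /set_mem Ax /set_mem Ay].
  have := cA x y (Itv01 t0 t1) (mem_set Ax) (mem_set Ay).
  by move=> /set_mem.
apply/mem_set; exact: cA.
Qed.

(** The induction is on the partial sums, each written as its total weight times
a point of A; this form spares the renormalisation of the weights and allows
partial sums of zero weight, for which any point of A, such as a0, will do. *)
Lemma convex_sum (R : realType) (V : lmodType R) (A : set V) (n : nat)
    (lam : 'I_n -> R) (f : 'I_n -> V) :
  @convex_set R V A -> (forall j, 0 <= lam j) -> \sum_j lam j = 1 ->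
  (forall j, 0 < lam j -> A (f j)) -> A (\sum_j lam j *: f j).
Proof.
move=> /convex_setP cA lam0 lam1 Af.
have [a0 Aa0] : exists a, A a.
  have [[j lamj]|lam_le0] := pselect (exists j, 0 < lam j).
    by exists (f j); apply: Af.
  suff : \sum_j lam j <= 0 by rewrite lam1 ler10.
  by apply: sumr_le0 => j _; rewrite leNgt; apply/negP => lamj; case: lam_le0; exists j.
suff [a Aa ->] : exists2 a, A a & \sum_j lam j *: f j = (\sum_j lam j) *: a.
  by rewrite lam1 scale1r.
elim: (index_enum _) => [|j r [a Aa IH]].
  by exists a0; rewrite ?big_nil ?scale0r.
rewrite !big_cons IH; set S := \sum_(k <- r) lam k.
have S0 : 0 <= S by apply: sumr_ge0.
have [lamj0|lamj] := eqVneq (lam j) 0.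
  by exists a => //; rewrite lamj0 scale0r !add0r.
have lamj_gt0 : 0 < lam j by rewrite lt_def lamj lam0.
have T_gt0 : 0 < lam j + S by rewrite ltr_pwDl.
exists ((lam j / (lam j + S)) *: f j + (1 - lam j / (lam j + S)) *: a).
  apply: cA => //; last exact: Af.
  - by rewrite divr_ge0 // ltW.
  - by rewrite ler_pdivrMr // mul1r lerDl.
rewrite scalerDr !scalerA mulrBr mulr1 mulrCA mulfV ?gt_eqF // mulr1.
by rewrite [lam j + S]addrC addrK.
Qed.

(** The two uses are complementary slackness and the fact that a supporting
hyperplane containing a mean contains each of the averaged points. *)
Lemma mean_eq_max (R : realType) (n : nat) (lam f : 'I_n -> R) (b : R) :
  (forall j, 0 <= lam j) -> \sum_j lam j = 1 -> (forall j, f j <= b) ->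
  \sum_j lam j * f j = b -> forall j, 0 < lam j -> f j = b.
Proof.
move=> lam0 lam1 fb mean j lamj.
have : \sum_k lam k * (b - f k) = 0.
  under eq_bigr do rewrite mulrBr.
  by rewrite sumrB -mulr_suml lam1 mul1r mean subrr.
move/eqP; rewrite psumr_eq0 => [/allP/(_ j (mem_index_enum _))|k _].
  by rewrite mulf_eq0 gt_eqF //= subr_eq0 => /eqP.
by rewrite mulr_ge0 // subr_ge0.
Qed.

(** * Supporting hyperplanes and the technology set *)

Lemma sum_scale_pair (R : realType) (m s n : nat) (lam : 'I_n -> R)
    (f : 'I_n -> 'cV[R]_m * 'cV[R]_s) :
  \sum_j lam j *: f j =
  (\sum_j lam j *: (f j).1, \sum_j lam j *: (f j).2).
Proof.
by rewrite [LHS]surjective_pairing; congr (_, _);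
  [rewrite (big_morph fst (id1 := 0) (op1 := +%R))
  |rewrite (big_morph snd (id1 := 0) (op1 := +%R))].
Qed.

Lemma innerD (R : realType) (m s : nat) (a x y : 'cV[R]_m * 'cV[R]_s) :
  inner a (x + y) = inner a x + inner a y.
Proof.
rewrite /inner addrACA -!big_split /=; congr (_ + _).
  by apply: eq_bigr => i _; rewrite mxE mulrDr.
by apply: eq_bigr => i _; rewrite mxE mulrDr.
Qed.

Lemma innerZ (R : realType) (m s : nat) (a x : 'cV[R]_m * 'cV[R]_s) t :
  inner a (t *: x) = t * inner a x.
Proof.
rewrite /inner mulrDr !mulr_sumr; congr (_ + _).
  by apply: eq_bigr => i _; rewrite mxE mulrCA.
by apply: eq_bigr => i _; rewrite mxE mulrCA.
Qed.

Lemma inner_sum (R : realType) (m s n : nat) (a : 'cV[R]_m * 'cV[R]_s)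
    (lam : 'I_n -> R) (f : 'I_n -> 'cV[R]_m * 'cV[R]_s) :
  inner a (\sum_j lam j *: f j) = \sum_j lam j * inner a (f j).
Proof.
rewrite (big_morph (inner a) (id1 := 0) (op1 := +%R)); last 2 first.
- exact: innerD.
- by rewrite -(scale0r 0) innerZ mul0r.
by apply: eq_bigr => j _; rewrite innerZ.
Qed.

Lemma DMU_technology (R : realType) (m s n : nat)
    (X : 'M[R]_(m, n)) (Y : 'M[R]_(s, n)) j :
  (forall i j, 0 <= X i j) -> (forall r j, 0 <= Y r j) ->
  technology X Y (DMU X Y j).
Proof.
move=> X0 Y0; split; first by move=> i; rewrite mxE.
split; first by move=> r; rewrite mxE.
have pick_j (c : 'I_n -> R) : \sum_k (k == j)%:R * c k = c j.
  rewrite (bigD1 j) //= eqxx mul1r big1 ?addr0 // => k /negPf ->.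
  by rewrite mul0r.
exists (fun k => (k == j)%:R); split=> [i|r||k].
- by rewrite pick_j mxE.
- by rewrite pick_j mxE.
- by have := pick_j (fun=> 1); under eq_bigr do rewrite mulr1.
- exact: ler0n.
Qed.

Lemma convex_technology (R : realType) (m s n : nat)
    (X : 'M[R]_(m, n)) (Y : 'M[R]_(s, n)) :
  @convex_set R ('cV[R]_m * 'cV[R]_s)%type (technology X Y).
Proof.
apply/convex_setP => x y t t0 t1.
move=> [x10 [x20 [la [la1 la2 laS la0]]]] [y10 [y20 [mu [mu1 mu2 muS mu0]]]].
have u0 : 0 <= 1 - t by rewrite subr_ge0.
have mixE (c : 'I_n -> R) : \sum_j (t * la j + (1 - t) * mu j) * c j =
    t * (\sum_j la j * c j) + (1 - t) * (\sum_j mu j * c j).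
  by rewrite !mulr_sumr -big_split; apply: eq_bigr => j _; rewrite mulrDl !mulrA.
split; first by move=> i; rewrite !mxE addr_ge0 // mulr_ge0.
split; first by move=> i; rewrite !mxE addr_ge0 // mulr_ge0.
exists (fun j => t * la j + (1 - t) * mu j); split=> [i|r||j].
- by rewrite mixE !mxE lerD // ler_wpM2l.
- by rewrite mixE !mxE lerD // ler_wpM2l.
- by rewrite big_split /= -!mulr_sumr laS muS !mulr1 subrKC.
- by rewrite addr_ge0 // mulr_ge0.
Qed.

Lemma convex_face (R : realType) (m s : nat) (T F : set ('cV[R]_m * 'cV[R]_s)) :
  @convex_set R ('cV[R]_m * 'cV[R]_s)%type T -> face T F ->
  @convex_set R ('cV[R]_m * 'cV[R]_s)%type F.
Proof.
move=> /convex_setP cT [H [a [b [_ HE _ _]]] FE].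
apply/convex_setP => x y t t0 t1; rewrite FE HE => -[/= xb Tx] [/= yb Ty].
split; last exact: cT.
by rewrite /= innerD !innerZ xb yb -mulrDl subrKC mul1r.
Qed.

(** * The RAM model as a linear program on gains *)

Definition gain (R : realType) (m s n : nat) (X : 'M[R]_(m, n))
    (Y : 'M[R]_(s, n)) (o : 'I_n) (z : 'cV[R]_m * 'cV[R]_s) : 'rV[R]_(m + s) :=
  row_mx (col o X - z.1)^T (z.2 - col o Y)^T.

Definition gain_mx (R : realType) (m s n : nat) (X : 'M[R]_(m, n))
    (Y : 'M[R]_(s, n)) (o : 'I_n) : 'M[R]_(n, m + s) :=
  \matrix_j gain X Y o (DMU X Y j).

Definition ram_weight (R : realType) (m s n : nat) (X : 'M[R]_(m, n))
    (Y : 'M[R]_(s, n)) (o : 'I_n) : 'cV[R]_(m + s) :=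
  col_mx (\col_i (spread o (X i))^-1) (\col_r (spread o (Y r))^-1).

Definition intensity_row (R : realType) (m s n : nat) (w : ram_sol R m s n) :
    'rV[R]_n :=
  \row_j intensity w j.

(** The normal vector of the level sets of gain(z) u, see [gain_mulmx]: inputs
enter the gain with a minus sign. *)
Definition gain_normal (R : realType) (m s : nat) (u : 'cV[R]_(m + s)) :
    'cV[R]_m * 'cV[R]_s :=
  (- usubmx u, dsubmx u).

Section Ram.
Variables (R : realType) (m s n : nat).
Variables (X : 'M[R]_(m, n)) (Y : 'M[R]_(s, n)) (o : 'I_n).

Local Notation gain := (gain X Y o).
Local Notation D := (gain_mx X Y o).
Local Notation wt := (ram_weight X Y o).

Lemma gain_inj : injective gain.
Proof.
move=> [x y] [x' y'] /eq_row_mx[/= /trmx_inj/addrI/oppr_inj -> /trmx_inj/addIr ->].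
by [].
Qed.

Lemma gain_mulmx (z : 'cV[R]_m * 'cV[R]_s) (u : 'cV_(m + s)) :
  (gain z *m u) 0 0 = inner (gain_normal u) z - inner (gain_normal u) (DMU X Y o).
Proof.
rewrite -[u in LHS]vsubmxK mul_row_col mxE ![in LHS]mxE /inner /= opprD addrACA.
congr (_ + _); rewrite -sumrB; apply: eq_bigr => i _; rewrite !mxE; ring.
Qed.

(** Weights of sum one are what makes the constant terms of the gain cancel. *)
Lemma gain_sum (lam : 'rV_n) : \sum_j lam 0 j = 1 ->
  gain (\sum_j lam 0 j *: DMU X Y j) = lam *m D.
Proof.
move=> lam1; rewrite sum_scale_pair; apply/rowP => k.
have DE j : D j k = gain (DMU X Y j) 0 k by rewrite mxE.
rewrite [RHS]mxE; under [RHS]eq_bigr do rewrite DE.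
case: (split_ordP k) => i ->.
  under [RHS]eq_bigr do rewrite row_mxEl !mxE mulrBr.
  rewrite row_mxEl !mxE sumrB -mulr_suml lam1 mul1r summxE.
  by congr (_ - _); apply: eq_bigr => j _; rewrite !mxE.
under [RHS]eq_bigr do rewrite row_mxEr !mxE mulrBr.
rewrite row_mxEr !mxE sumrB -mulr_suml lam1 mul1r summxE.
by congr (_ - _); apply: eq_bigr => j _; rewrite !mxE.
Qed.

Lemma row_gain_mx0 : row o D = 0.
Proof. by rewrite rowK /gain !subrr !trmx0 row_mx0. Qed.

Lemma sum_row (lam : 'I_n -> R) : \sum_j (\row_j lam j) 0 j = \sum_j lam j.
Proof. by apply: eq_bigr => j _; rewrite mxE. Qed.

Lemma sum_scale_col p (Z : 'M[R]_(p, n)) (lam : 'I_n -> R) (i : 'I_p) :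
  (\sum_j (\row_j lam j) 0 j *: col j Z) i 0 = \sum_j lam j * Z i j.
Proof. by rewrite summxE; apply: eq_bigr => j _; rewrite !mxE. Qed.

(** The equations say that the projection is the convex combination of the DMUs,
and the slacks are its gain, which makes their signs those of lambda D. *)
Lemma ram_feasibleP (w : ram_sol R m s n) :
  ram_feasible X Y o w <->
  lp_feasible D (intensity_row w) /\
  projection X Y o w = \sum_j intensity_row w 0 j *: DMU X Y j.
Proof.
set lam := intensity_row w.
have sumE p (Z : 'M[R]_(p, n)) := sum_scale_col Z (intensity w).
have sum_lam : \sum_j lam 0 j = \sum_j intensity w j by apply: sum_row.
have gainE : gain (projection X Y o w) = row_mx (in_slack w)^T (out_slack w)^T.
  by rewrite /gain /projection /= opprB addrC subrK [_ + _ - _]addrC addKr.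
split=> [[inE outE sum1 w0 [sm0 sp0]]|[[lam0 lam1 lamD] projE]].
  have projE : projection X Y o w = \sum_j lam 0 j *: DMU X Y j.
    rewrite sum_scale_pair; congr (_, _); apply/colP => i; rewrite sumE !mxE.
      by rewrite -inE addrK.
    by rewrite -outE subrK.
  split=> //; split; rewrite ?sum_lam //.
    by move=> i j; rewrite mxE.
  rewrite -gain_sum ?sum_lam // -projE gainE.
  by apply: nonneg_row_mx => i j; rewrite mxE ord1.
move: projE; rewrite sum_scale_pair => -[/colP inE /colP outE].
rewrite -gain_sum // in lamD; rewrite sum_lam in lam1.
have projE : projection X Y o w = \sum_j lam 0 j *: DMU X Y j.
  by rewrite sum_scale_pair; congr (_, _); apply/colP.
rewrite -projE gainE in lamD.
split=> //.
- by move=> i; have := inE i; rewrite sumE !mxE => <-; rewrite subrK.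
- by move=> r; have := outE r; rewrite sumE !mxE => <-; rewrite addrK.
- by move=> j; have := lam0 0 j; rewrite mxE.
split=> [i|r].
  by have := lamD 0 (lshift s i); rewrite row_mxEl mxE.
by have := lamD 0 (rshift m r); rewrite row_mxEr mxE.
Qed.

Lemma ram_objE (w : ram_sol R m s n) :
  ram_obj X Y o w =
  1 - (m + s)%:R^-1 * (gain (projection X Y o w) *m wt) 0 0.
Proof.
rewrite mul_row_col mxE ![in RHS]mxE; congr (1 - _ * (_ + _)).
  by apply: eq_bigr => i _; rewrite !mxE opprB addrC subrK.
by apply: eq_bigr => i _; rewrite !mxE [_ + _ - _]addrC addKr.
Qed.

Lemma ram_weight_gt0 k :
  (forall i, spread o (X i) != 0) -> (forall r, spread o (Y r) != 0) ->
  0 < wt k 0.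
Proof.
move=> X0 Y0.
have spread_gt0 (f : 'I_n -> R) : spread o f != 0 -> 0 < (spread o f)^-1.
  move=> f0; rewrite invr_gt0 lt_def f0 subr_ge0.
  exact: le_trans (bigmin_le_id _ _ _ _) (bigmax_ge_id _ _ _ _).
by rewrite mxE; case: splitP => i _; rewrite mxE spread_gt0.
Qed.

(** The slacks are determined by the weights, as the gain of the combination. *)
Definition sol_of (lam : 'rV[R]_n) : ram_sol R m s n :=
  RamSol (fun j => lam 0 j) (lsubmx (lam *m D))^T (rsubmx (lam *m D))^T.

Lemma projection_sol_of (lam : 'rV_n) : \sum_j lam 0 j = 1 ->
  projection X Y o (sol_of lam) = \sum_j lam 0 j *: DMU X Y j.
Proof.
move=> lam1; apply: gain_inj; rewrite gain_sum // /gain /projection /=.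
by rewrite opprB addrC subrK [_ + _ - _]addrC addKr !trmxK hsubmxK.
Qed.

(** Free disposal, in terms of gains. *)
Lemma technology_gain z : technology X Y z ->
  exists lam : 'rV_n, [/\ nonneg_mx lam, \sum_j lam 0 j = 1
    & forall k, gain z 0 k <= (lam *m D) 0 k].
Proof.
move=> [_ [_ [lam [inP outP lam1 lam0]]]].
pose la : 'rV_n := \row_j lam j.
have la1 : \sum_j la 0 j = 1 by rewrite sum_row.
exists la; split=> // [i j|k]; first by rewrite mxE.
rewrite -gain_sum // sum_scale_pair.
case: (split_ordP k) => i ->; rewrite !(row_mxEl, row_mxEr) !mxE sum_scale_col.
  by rewrite lerD2l lerN2.
by rewrite lerD2r.
Qed.

End Ram.

(** * The minimum face *)

Lemma DMU_in_face (R : realType) (m s n : nat)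
    (X : 'M[R]_(m, n)) (Y : 'M[R]_(s, n)) (o : 'I_n)
    (F : set ('cV[R]_m * 'cV[R]_s)) (j : 'I_n) :
  (forall i j, 0 <= X i j) -> (forall r j, 0 <= Y r j) ->
  face (technology X Y) F -> projection_set X Y o `<=` F ->
  global_reference_set X Y o j -> F (DMU X Y j).
Proof.
move=> X0 Y0 [H [a [b [_ HE Tb _]]] ->] projF [_ _ [w [w_opt _ wj]]].
have T_DMU k := DMU_technology k X0 Y0.
split; last exact: T_DMU.
have [+ _] : (H `&` technology X Y) (projection X Y o w) by apply: projF; exists w.
have [/ram_feasibleP[[lam0 lam1 _] ->] _] := w_opt.
rewrite HE /= inner_sum => mean.
apply: (mean_eq_max _ lam1 _ mean) => [k|k|]; first exact: lam0.
  exact/Tb/T_DMU.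
by rewrite mxE.
Qed.

Lemma hull_sub_minimum_face (R : realType) (m s n : nat)
    (X : 'M[R]_(m, n)) (Y : 'M[R]_(s, n)) (o : 'I_n) :
  (forall i j, 0 <= X i j) -> (forall r j, 0 <= Y r j) ->
  convex_hull [set DMU X Y j | j in global_reference_set X Y o]
    `<=` minimum_face X Y o.
Proof.
move=> X0 Y0 z hz F [faceF projF]; move: z hz; apply: smallest_sub.
  by apply: convex_face faceF; apply: convex_technology.
by move=> _ [j jG <-]; apply: DMU_in_face projF jG.
Qed.

(** Let lam be convex weights whose combination of DMUs dominates z.  From
gain(z) u <= lam D u <= V, equality throughout forces the combination to be z,
since u > 0, and its weights to live on the rows where D u = V. *)
Lemma positive_face_sub_hull (R : realType) (m s n : nat)
    (X : 'M[R]_(m, n)) (Y : 'M[R]_(s, n)) (o : 'I_n)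
    (u : 'cV[R]_(m + s)) (V : R) (z : 'cV[R]_m * 'cV[R]_s) (J : set 'I_n) :
  (forall k, 0 < u k 0) ->
  (forall j, (gain_mx X Y o *m u) j 0 <= V) ->
  (forall j, (gain_mx X Y o *m u) j 0 = V -> J j) ->
  technology X Y z ->
  (gain X Y o z *m u) 0 0 <= V /\
  ((gain X Y o z *m u) 0 0 = V -> convex_hull [set DMU X Y j | j in J] z).
Proof.
move=> u0 DV DJ Tz; have [lam [lam0 lam1 z_lam]] := technology_gain o Tz.
pose D := gain_mx X Y o.
have slack0 : nonneg_mx (lam *m D - gain X Y o z).
  by move=> i k; rewrite ord1 mxE [X in _ + X]mxE subr_ge0.
have lamDu : (lam *m D *m u) 0 0 = \sum_j lam 0 j * (D *m u) j 0.
  by rewrite -mulmxA mxE.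
have lamDu_le : (lam *m D *m u) 0 0 <= V.
  rewrite lamDu -[leRHS]mul1r -lam1 mulr_suml.
  by apply: ler_sum => j _; rewrite ler_wpM2l.
have zE : (gain X Y o z *m u) 0 0 =
    (lam *m D *m u) 0 0 - ((lam *m D - gain X Y o z) *m u) 0 0.
  have mx11B (A B : 'M[R]_1) : (A - B) 0 0 = A 0 0 - B 0 0 by rewrite !mxE.
  by rewrite mulmxBl mx11B subKr.
have slack_u : 0 <= ((lam *m D - gain X Y o z) *m u) 0 0.
  by apply: nonneg_mxM => // i j; rewrite ord1 ltW.
split=> [|zV]; first by rewrite zE lerBlDr ler_wpDr.
have lamDuV : (lam *m D *m u) 0 0 = V.
  by apply/le_anti; rewrite lamDu_le -zV zE lerBlDr lerDl.
have /eqP : ((lam *m D - gain X Y o z) *m u) 0 0 = 0.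
  by move/eqP: zE; rewrite zV lamDuV eq_sym subr_eq addrC -subr_eq subrr eq_sym => /eqP.
rewrite mxE psumr_eq0 => [/allP slack_eq0|k _]; last by rewrite mulr_ge0 // ltW.
have gainz : gain X Y o z = gain X Y o (\sum_j lam 0 j *: DMU X Y j).
  rewrite gain_sum //; apply/rowP => k.
  have := slack_eq0 k (mem_index_enum _).
  by rewrite mulf_eq0 orbC gt_eqF //= mxE [X in _ + X]mxE subr_eq0 => /eqP.
rewrite (gain_inj gainz) => K [cK JK].
apply: convex_sum => // j lamj; apply: JK; exists j => //; apply: DJ.
by apply: (mean_eq_max (lam0 0) lam1 DV _ lamj); rewrite -lamDu.
Qed.

Theorem theorem3p1p1 (R : realType) (m s n : nat)
    (X : 'M[R]_(m, n)) (Y : 'M[R]_(s, n))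
    (X_ge0 : forall i j, 0 <= X i j) (Y_ge0 : forall r j, 0 <= Y r j)
    (o : 'I_n)
    (spreadX_neq0 : forall i, spread o (X i) != 0)
    (spreadY_neq0 : forall r, spread o (Y r) != 0) :
  minimum_face X Y o =
  convex_hull [set DMU X Y j | j in global_reference_set X Y o].
Proof.
apply/seteqP; split; last exact: hull_sub_minimum_face.
have [mu [y [mu_feas y0 DV D_mu]]] :=
  lp_strict_complementarity (ram_weight X Y o) (row_gain_mx0 X Y o).
move: DV D_mu; set wt := ram_weight X Y o; set u := wt + y.
set V := (mu *m _ *m _) 0 0; set D := gain_mx X Y o => DV D_mu.
have [mu0 mu1 muD0] := mu_feas.
have u_gt0 k : 0 < u k 0.
  by rewrite mxE ltr_wpDr // ram_weight_gt0.
have mu_opt : ram_optimal X Y o (sol_of X Y o mu).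
  have mu_int : intensity_row (sol_of X Y o mu) = mu.
    by apply/rowP => j; rewrite mxE.
  split; first by apply/ram_feasibleP; rewrite mu_int projection_sol_of.
  move=> w' /ram_feasibleP[lam_feas projE].
  rewrite !ram_objE projection_sol_of // projE !gain_sum //; last by case: lam_feas.
  rewrite lerB // ler_wpM2l ?invr_ge0 ?ler0n //.
  by have /andP[] := lp_weak_duality y0 DV lam_feas; apply: le_trans.
have GRS_mu j : 0 < mu 0 j -> global_reference_set X Y o j.
  move=> muj; exists (projection X Y o (sol_of X Y o mu)).
    by exists (sol_of X Y o mu).
  by exists (sol_of X Y o mu).
have D_GRS j (DjV : (D *m u) j 0 = V) : global_reference_set X Y o j.
  by apply/GRS_mu/D_mu.
have exposed z (Tz : technology X Y z) := positive_face_sub_hull u_gt0 DV D_GRS Tz.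
(* Without coordinates there is no hyperplane, and the inclusion comes from the
   hull being the whole space. *)
have [ms0|ms_gt0] := posnP (m + s).
  have empty (k : 'I_(m + s)) : False by move: k; rewrite ms0 => -[].
  move=> z _; have zE : z = DMU X Y o.
    by apply: (@gain_inj _ _ _ _ X Y o); apply/rowP => k; case: (empty k).
  apply: (exposed z _).2; first by rewrite zE; apply: DMU_technology.
  by rewrite /V !mxE !big1 // => k; case: (empty k).
pose a := gain_normal u.
pose b := V + inner a (DMU X Y o).
have inner_b z : (inner a z = b) <-> (gain X Y o z *m u) 0 0 = V.
  by rewrite gain_mulmx -/a; split=> [->|/(canRL (subrK _))//]; rewrite addrK.
(* An optimal solution has value V, and u = w + y can only increase it, while
   weak duality bounds the increased value by V. *)
have proj_sub : projection_set X Y o `<=`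
    [set z | inner a z = b] `&` technology X Y.
  move=> _ [w [/ram_feasibleP[lam_feas projE] w_opt] <-].
  have [lam0 lam1 lamD0] := lam_feas.
  split; last first.
    rewrite projE; apply: convex_sum => //; first exact: convex_technology.
    by move=> j _; apply: DMU_technology.
  apply/inner_b; rewrite projE gain_sum //.
  have /andP[le_u leV] := lp_weak_duality y0 DV lam_feas.
  apply/le_anti; rewrite leV /= (le_trans _ le_u) //.
  have := w_opt _ (proj1 mu_opt).
  rewrite !ram_objE projection_sol_of // projE !gain_sum //.
  by rewrite lerD2l lerN2 ler_pM2l // invr_gt0 ltr0n.
move=> z /(_ ([set z | inner a z = b] `&` technology X Y)) -[].
  split=> //; exists [set z | inner a z = b] => //; exists a, b; split=> //.
  - move=> a_eq0.
    have := u_gt0 (Ordinal ms_gt0); rewrite -[u]vsubmxK.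
    case: a_eq0 => /(canRL opprK) -> ->.
    by rewrite oppr0 col_mx0 mxE ltxx.
  - move=> x Tx /=; rewrite -subr_ge0 /b.
    have [+ _] := exposed x Tx; rewrite gain_mulmx -/a -subr_ge0.
    by rewrite opprB addrA.
  - exists (projection X Y o (sol_of X Y o mu)); apply: proj_sub.
    by exists (sol_of X Y o mu).
by move=> /inner_b zV Tz; apply: (exposed z Tz).2.
Qed.
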